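(* Consider the problem (RecSMSP): given $n$ jobs $N=\{1,\dots,n\}$ with first-stage processing times $p_j\ge 0$, second-stage processing times $q_j\ge 0$, and an integer $\Delta\in\{0,\dots,n\}$, solve \[ \min\ \sum_{i\in N}\sum_{j\in N}p_j(n+1-i)x_{ij}+\sum_{i\in N}\sum_{j\in N}q_j(n+1-i)y_{ij}\quad\text{s.t. } \sum_{i\in N}\sum_{j\in N}x_{ij}y_{ij}\ge\Delta,\ \bm{x},\bm{y}\in\mathcal{X}. \] Let (UB-SMSP) be the same problem with the constraint replaced by $\sum_{i,j}x_{ij}y_{ij}=n$ (i.e. $\bm{x}=\bm{y}$), equivalently $\min_{\bm{x}\in\mathcal{X}}\sum_{i\in N}\sum_{j\in N}(p_j+q_j)(n+1-i)x_{ij}$. Then an optimal solution of (UB-SMSP) (taking $\bm{y}=\bm{x}$) is a feasible solution of (RecSMSP) whose objective value is at most twice the optimal value of (RecSMSP); i.e. it provides a 2-approximation to (RecSMSP).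
   Context: $\mathcal{X}$ denotes the set of $n\times n$ permutation matrices ($\bm{x}\in\{0,1\}^{n\times n}$ with every row and every column summing to $1$); $x_{ij}=1$ means job $j$ is in position $i$ of the first-stage schedule, $y_{ij}=1$ means job $j$ is in position $i$ of the second-stage schedule. *)

(* Defs.v *)
From HB Require Import structures.
From mathcomp Require Import all_boot all_order all_algebra.
Set Implicit Arguments.
Unset Strict Implicit.
Unset Printing Implicit Defensive.
Import Order.TTheory GRing.Theory Num.Theory.
Local Open Scope ring_scope.

Definition is_optimal (R : realFieldType) (T : Type) (feasible : T -> Prop)
    (cost : T -> R) (t : T) : Prop :=
  feasible t /\ forall u, feasible u -> cost t <= cost u.

Definition is_optimal_value (R : realFieldType) (T : Type)
    (feasible : T -> Prop) (cost : T -> R) (v : R) : Prop :=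
  exists2 t, is_optimal feasible cost t & v = cost t.

(* The set X of schedules: x i j = 1 iff job j is in position i. *)
Definition schedule (R : realFieldType) (n : nat) (x : 'M[R]_n) : Prop :=
  [/\ forall i j, x i j = 0 \/ x i j = 1,
      forall i, \sum_j x i j = 1
    & forall j, \sum_i x i j = 1].

(* Ordinals start at 0: i : 'I_n stands for the position i.+1 of {1, ..., n},
   hence the weight n + 1 - i.+1. *)
Definition sched_cost (R : realFieldType) (n : nat) (p : 'I_n -> R)
    (x : 'M[R]_n) : R :=
  \sum_(i < n) \sum_(j < n) p j * (n%:R + 1 - i.+1%:R) * x i j.

Definition overlap (R : realFieldType) (n : nat) (x y : 'M[R]_n) : R :=
  \sum_i \sum_j x i j * y i j.

Definition rec_cost (R : realFieldType) (n : nat) (p q : 'I_n -> R)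
    (xy : 'M[R]_n * 'M[R]_n) : R :=
  sched_cost p xy.1 + sched_cost q xy.2.

Definition rec_feasible (R : realFieldType) (n Delta : nat)
    (xy : 'M[R]_n * 'M[R]_n) : Prop :=
  [/\ schedule xy.1, schedule xy.2 & Delta%:R <= overlap xy.1 xy.2].

Definition ub_feasible (R : realFieldType) (n : nat)
    (xy : 'M[R]_n * 'M[R]_n) : Prop :=
  [/\ schedule xy.1, schedule xy.2 & overlap xy.1 xy.2 = n%:R].

(* Main.v *)
(** Measure the position of a job from the end of the schedule, so that job [j]
    contributes [p j] times its reversed position, a number in [{1, ..., n}].
    Let [a j] and [b j] be the reversed positions of [j] in an optimal pair of
    schedules.  At most [2 * k] jobs satisfy [min (a j) (b j) <= k], so listing
    the jobs by increasing [min (a j) (b j)] gives a single schedule in which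
    the reversed position of every job is at most [2 * min (a j) (b j)]; its
    cost is therefore at most twice that of the pair. *)
Require Import Defs.
From HB Require Import structures.
From mathcomp Require Import all_boot all_order all_algebra.
From mathcomp Require Import fingroup perm.
Import Order.TTheory GRing.Theory Num.Theory.
Local Open Scope ring_scope.
Set Implicit Arguments.
Unset Strict Implicit.
Unset Printing Implicit Defensive.

(** Some entry is nonzero, hence 1. The others are nonnegative and sum to 0, so they all vanish. *)
Lemma sum01_eq1 (R : realFieldType) (I : finType) (F : I -> R) :
  (forall i, F i = 0 \/ F i = 1) -> \sum_i F i = 1 ->
  exists i, forall k, F k = (i == k)%:R.
Proof.
move=> F01 sumF.
have F_ge0 k : 0 <= F k by case: (F01 k) => ->.
have [i Fi1] : exists i, F i = 1.
  case: (pickP [pred i | F i != 0]) => [i /= Fi | F0].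
    by exists i; case: (F01 i) Fi => // ->; rewrite eqxx.
  have /eqP := sumF; rewrite big1 => [|i _]; first by rewrite eq_sym oner_eq0.
  by apply/eqP; have /negbFE := F0 i.
exists i => k; case: eqVneq => [<- //|neq_ik].
move: sumF; rewrite (bigD1 i) //= Fi1 => /(congr1 (fun u => u - 1)).
rewrite addrAC subrr add0r => /psumr_eq0P; apply => //.
by rewrite eq_sym.
Qed.

(** [r j] counts the jobs after [j], so the reversed position of [j] is [(r j).+1], which is exactly
    its weight in the cost. *)
Definition revpos_mx (R : realFieldType) (n : nat) (r : {perm 'I_n}) : 'M[R]_n :=
  \matrix_(i, j) (r j == rev_ord i)%:R.

Lemma schedule_revpos_mx (R : realFieldType) n (r : {perm 'I_n}) :
  schedule (revpos_mx R r).
Proof.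
have sum_delta (k : 'I_n) : \sum_(i < n) (i == k)%:R = 1 :> R.
  by rewrite (bigD1 k) //= eqxx big1 ?addr0 // => i /negPf ->.
split=> [i j|i|j].
- by rewrite mxE; case: eqP; [right | left].
- rewrite (reindex_inj (@perm_inj _ r^-1%g)) /= -[RHS](sum_delta (rev_ord i)).
  by apply: eq_bigr => j _; rewrite mxE permKV.
- rewrite (reindex_inj rev_ord_inj) /= -[RHS](sum_delta (r j)).
  by apply: eq_bigr => i _; rewrite mxE rev_ordK eq_sym.
Qed.

Lemma schedule_revposP (R : realFieldType) n (x : 'M[R]_n) :
  schedule x -> exists r : {perm 'I_n}, x = revpos_mx R r.
Proof.
case=> x01 rows cols.
have col_delta j : exists i, forall k, x k j = (i == k)%:R.
  by apply: (sum01_eq1 (F := fun k => x k j)).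
have row_delta i : exists j, forall k, x i k = (j == k)%:R by apply: sum01_eq1.
have col_one j : exists i, x i j == 1.
  by have [i xi] := col_delta j; exists i; rewrite xi eqxx.
(* The columns give each job [j] its position [f j]; the rows then make [f] injective. *)
pose f j := xchoose (col_one j).
have xf j : x (f j) j = 1 by apply/eqP/(xchooseP (col_one j)).
have xE i j : x i j = (f j == i)%:R.
  have [k xk] := col_delta j.
  suff -> : f j = k by [].
  by move: (xf j); rewrite xk; case: eqP => // _ /eqP; rewrite eq_sym oner_eq0.
have f_inj : injective f.
  move=> j j' eq_f; have [k xk] := row_delta (f j).
  have row_one l : x (f j) l = 1 -> k = l.
    by rewrite xk; case: eqP => // _ /eqP; rewrite eq_sym oner_eq0.
  by rewrite -(row_one j (xf j)) -(row_one j') // eq_f xf.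
have g_inj : injective (@rev_ord n \o f) by apply: inj_comp rev_ord_inj f_inj.
exists (perm g_inj); apply/matrixP => i j.
by rewrite xE mxE permE /= (inj_eq rev_ord_inj).
Qed.

Lemma sched_cost_revpos (R : realFieldType) n (p : 'I_n -> R) (r : {perm 'I_n}) :
  sched_cost p (revpos_mx R r) = \sum_j p j * (r j).+1%:R.
Proof.
rewrite /sched_cost exchange_big; apply: eq_bigr => j _.
rewrite (bigD1 (rev_ord (r j))) //= big1 => [|i neq_i].
  rewrite mxE rev_ordK eqxx mulr1 addr0; congr (_ * _).
  rewrite natr1 -natrB ?ltnS ?leq_subr // subSS.
  by rewrite subKn.
rewrite mxE; case: eqP => [rj|_]; last by rewrite mulr0.
by rewrite rj rev_ordK eqxx in neq_i.
Qed.

Lemma overlap_revpos (R : realFieldType) n (r s : {perm 'I_n}) :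
  overlap (revpos_mx R r) (revpos_mx R s) = \sum_j (r j == s j)%:R.
Proof.
rewrite /overlap exchange_big; apply: eq_bigr => j _.
rewrite (bigD1 (rev_ord (r j))) //= big1 => [|i neq_i].
  by rewrite !mxE rev_ordK eqxx mul1r addr0 eq_sym.
rewrite mxE; case: eqP => [rj|_]; last by rewrite mul0r.
by rewrite rj rev_ordK eqxx in neq_i.
Qed.

Lemma overlap_self (R : realFieldType) n (x : 'M[R]_n) :
  schedule x -> overlap x x = n%:R.
Proof.
case/schedule_revposP=> r ->; rewrite overlap_revpos.
under eq_bigr do rewrite eqxx.
by rewrite sumr_const card_ord.
Qed.

Lemma overlap_full (R : realFieldType) n (x y : 'M[R]_n) :
  schedule x -> schedule y -> overlap x y = n%:R <-> x = y.
Proof.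
move=> sx sy; split=> [|<-]; last exact: overlap_self.
case: (schedule_revposP sx) (schedule_revposP sy) => [r ->] [s ->].
rewrite overlap_revpos => eq_n; suff -> : r = s by [].
(* The overlap counts the jobs placed alike. If it equals [n], these nonnegative gaps sum to 0, so
   each is 0. *)
have gaps0 : \sum_j (1 - (r j == s j)%:R) = 0 :> R.
  by rewrite sumrB eq_n sumr_const card_ord subrr.
apply/permP => j; apply/eqP.
have /psumr_eq0P/(_ j isT)/eqP := gaps0 => gap.
have : (1 : R) - (r j == s j)%:R == 0.
  by apply: gap => k _; rewrite subr_ge0 lern1 leq_b1.
by case: (r j == s j) => //; rewrite subr0 oner_eq0.
Qed.

Lemma rec_cost_diag (R : realFieldType) n (p q : 'I_n -> R) (x : 'M[R]_n) :
  rec_cost p q (x, x) = sched_cost (fun j => p j + q j) x.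
Proof.
rewrite /rec_cost /sched_cost -big_split; apply: eq_bigr => i _ /=.
by rewrite -big_split; apply: eq_bigr => j _; rewrite /= -!mulrDl.
Qed.

Lemma ub_feasibleP (R : realFieldType) n (x y : 'M[R]_n) :
  ub_feasible (x, y) <-> x = y /\ schedule x.
Proof.
split=> [[/= sx sy /(overlap_full sx sy) eq_xy] | [<- sx]] //.
by split=> //=; apply: overlap_self.
Qed.

Lemma ub_optimalP (R : realFieldType) n (p q : 'I_n -> R) (x y : 'M[R]_n) :
  is_optimal (@ub_feasible R n) (rec_cost p q) (x, y) <->
  x = y /\ is_optimal (@schedule R n) (sched_cost (fun j => p j + q j)) x.
Proof.
split=> [[/ub_feasibleP[<- sx] opt] | [<- [sx opt]]].
  split=> //; split=> // z sz; rewrite -!rec_cost_diag.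
  by apply: opt; apply/ub_feasibleP.
split; first exact/ub_feasibleP.
by case=> u _ /ub_feasibleP[<- su]; rewrite !rec_cost_diag; apply: opt.
Qed.

Lemma ub_optimal_valueP (R : realFieldType) n (p q : 'I_n -> R) (v : R) :
  is_optimal_value (@ub_feasible R n) (rec_cost p q) v <->
  is_optimal_value (@schedule R n) (sched_cost (fun j => p j + q j)) v.
Proof.
split=> [[[x y] /ub_optimalP[<- opt] ->] | [x opt ->]].
  by exists x => //; rewrite rec_cost_diag.
by exists (x, x); rewrite ?rec_cost_diag //; apply/ub_optimalP.
Qed.

(** The feasible points are the images under [f] of a nonempty finite set of indices, so the minimum
    is attained although [T] may be infinite. *)
Lemma is_optimal_exists (R : realFieldType) (I : finType) (T : Type)
    (feasible : T -> Prop) (cost : T -> R) (f : I -> T) (P : pred I) (i0 : I) :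
  P i0 -> (forall i, P i -> feasible (f i)) ->
  (forall t, feasible t -> exists2 i, P i & t = f i) ->
  exists t, is_optimal feasible cost t.
Proof.
move=> Pi0 feasP Pfeas; case: (arg_minP (cost \o f) Pi0) => i Pi min_i.
exists (f i); split=> [|t /Pfeas[k Pk ->]]; first exact: feasP.
exact: min_i.
Qed.

Lemma schedule_optimal_exists (R : realFieldType) n (p : 'I_n -> R) :
  exists x, is_optimal (@schedule R n) (sched_cost p) x.
Proof.
apply: (@is_optimal_exists _ _ _ _ _ (@revpos_mx R n) predT 1%g) => //.
- by move=> r _; apply: schedule_revpos_mx.
- by move=> x /schedule_revposP[r ->]; exists r.
Qed.

Lemma rec_optimal_exists (R : realFieldType) n Delta (p q : 'I_n -> R) :
  (Delta <= n)%N ->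
  exists xy, is_optimal (@rec_feasible R n Delta) (rec_cost p q) xy.
Proof.
move=> le_Dn.
pose f (rs : {perm 'I_n} * {perm 'I_n}) := (revpos_mx R rs.1, revpos_mx R rs.2).
(* Two equal schedules overlap in [n >= Delta] places, so the pair of identities is feasible. *)
apply: (@is_optimal_exists _ _ _ _ _ f
  (fun rs => Delta%:R <= overlap (f rs).1 (f rs).2) (1%g, 1%g)).
- by rewrite overlap_self ?ler_nat //; apply: schedule_revpos_mx.
- by move=> rs feas; split=> //; apply: schedule_revpos_mx.
- case=> x y [/= /schedule_revposP[r ->] /schedule_revposP[s ->] feas].
  by exists (r, s).
Qed.

(* Ties in [m] are broken by the index, through the injective key
   [m i * n + i]. *)
Lemma rank_perm n (m : 'I_n -> nat) :
  exists r : {perm 'I_n}, forall j, (r j < #|[set i | m i <= m j]|)%N.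
Proof.
pose key (i : 'I_n) := (m i * n + i)%N.
have m_key i j : (key i <= key j)%N -> (m i <= m j)%N.
  move=> le_ij; rewrite leqNgt; apply/negP => lt_m; move: le_ij.
  rewrite leqNgt => /negP; apply; rewrite /key.
  (* As [j < n], the key of [j] is below [(m j).+1 * n], which is at most [m i * n]. *)
  apply: (@leq_trans ((m j).+1 * n)); first by rewrite mulSnr ltn_add2l.
  by rewrite (leq_trans _ (leq_addr _ _)) // leq_mul2r lt_m orbT.
have key_inj : injective key.
  move=> i j eq_ij; apply/val_inj.
  have eq_m : m i = m j by apply/eqP; rewrite eqn_leq !m_key ?eq_ij.
  by move/eqP: eq_ij; rewrite /key eq_m eqn_add2l => /eqP.
(* The 0-based rank of [j] is the size of [below j]. The strict bound holds because [j] itself lies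
   in the larger set only. *)
pose below j := [set i | (key i < key j)%N].
have below_lt j : (#|below j| < #|[set i | m i <= m j]|)%N.
  apply/proper_card/properP; split.
    by apply/subsetP => i; rewrite !inE => /ltnW/m_key.
  by exists j; rewrite !inE ?ltnn.
have below_ltn j : (#|below j| < n)%N.
  by rewrite (leq_trans (below_lt j)) // -[leqRHS]card_ord max_card.
have below_mono i j : (key i < key j)%N -> (#|below i| < #|below j|)%N.
  move=> lt_ij; apply/proper_card/properP; split.
    by apply/subsetP => k; rewrite !inE => /ltn_trans; apply.
  by exists i; rewrite !inE ?ltnn.
have r_inj : injective (fun j => Ordinal (below_ltn j)).
  move=> i j [eq_ij]; apply: key_inj; apply/eqP.
  by case: ltngtP => // /below_mono; rewrite eq_ij ltnn.
by exists (perm r_inj) => j; rewrite permE; apply: below_lt.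
Qed.

Lemma card_perm_le n (r : {perm 'I_n}) (c : nat) :
  (#|[set i | r i <= c]| <= c.+1)%N.
Proof.
rewrite -[leqRHS]card_ord.
(* On this set [r i < c.+1], so [inord] keeps the value and injectivity comes from [r]. *)
apply: (@leq_card_in _ _ (fun i => inord (r i) : 'I_c.+1)) => i j.
rewrite !inE => ri rj /(congr1 val); rewrite /= !inordK // => /val_inj.
exact: perm_inj.
Qed.

Lemma merge_perms n (r s : {perm 'I_n}) :
  exists t : {perm 'I_n}, forall j, ((t j).+1 <= 2 * (minn (r j) (s j)).+1)%N.
Proof.
have [t tP] := rank_perm (fun j => minn (r j) (s j)).
exists t => j; set c := minn (r j) (s j).
apply: leq_trans (tP j) _; rewrite -/c.
(* Each of the two sets has at most [c.+1] elements, whence the factor 2. *)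
have -> : [set i | (minn (r i) (s i) <= c)%N] =
    [set i | (r i <= c)%N] :|: [set i | (s i <= c)%N].
  by apply/setP => i; rewrite !inE geq_min.
rewrite (leq_trans (leq_card_setU _ _)) // mul2n -addnn.
by rewrite leq_add // card_perm_le.
Qed.

Lemma merged_schedule (R : realFieldType) n (p q : 'I_n -> R) (x y : 'M[R]_n) :
  (forall j, 0 <= p j) -> (forall j, 0 <= q j) -> schedule x -> schedule y ->
  exists2 z, schedule z & rec_cost p q (z, z) <= 2 * rec_cost p q (x, y).
Proof.
move=> p_ge0 q_ge0 /schedule_revposP[r ->] /schedule_revposP[s ->].
have [t tP] := merge_perms r s.
exists (revpos_mx R t); first exact: schedule_revpos_mx.
rewrite /rec_cost /= !sched_cost_revpos mulrDr !mulr_sumr.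
(* Job by job, the minimum is bounded by [r j] in the [p] terms and by [s j] in the [q] terms. *)
by apply: lerD; apply: ler_sum => j _; rewrite mulrCA ler_wpM2l // -natrM ler_nat
  (leq_trans (tP j)) // leq_mul2l ltnS ?geq_minl ?geq_minr.
Qed.

Theorem theorem2 (R : realFieldType) (n Delta : nat) (p q : 'I_n -> R)
    (hp : forall j, 0 <= p j) (hq : forall j, 0 <= q j)
    (hDelta : (Delta <= n)%N) :
  (* the constraint of (UB-SMSP) says x = y *)
  (forall x y : 'M[R]_n, schedule x -> schedule y ->
     (overlap x y = n%:R <-> x = y)) /\
  (* (UB-SMSP) is equivalent to the single-schedule problem *)
  (forall x y : 'M[R]_n,
     is_optimal (@ub_feasible R n) (rec_cost p q) (x, y) <->
     x = y /\
     is_optimal (@schedule R n) (sched_cost (fun j => p j + q j)) x) /\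
  (forall v : R,
     is_optimal_value (@ub_feasible R n) (rec_cost p q) v <->
     is_optimal_value (@schedule R n) (sched_cost (fun j => p j + q j)) v) /\
  (exists xy : 'M[R]_n * 'M[R]_n,
     is_optimal (@ub_feasible R n) (rec_cost p q) xy) /\
  (* 2-approximation *)
  exists opt : R,
    is_optimal_value (@rec_feasible R n Delta) (rec_cost p q) opt /\
    forall xy : 'M[R]_n * 'M[R]_n,
      is_optimal (@ub_feasible R n) (rec_cost p q) xy ->
      rec_feasible Delta xy /\ rec_cost p q xy <= 2 * opt.
Proof.
split; first exact: overlap_full.
split; first exact: ub_optimalP.
split; first exact: ub_optimal_valueP.
split.
  have [x opt] := schedule_optimal_exists (fun j => p j + q j).
  by exists (x, x); apply/ub_optimalP.
have [[x y] opt] := rec_optimal_exists p q hDelta.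
exists (rec_cost p q (x, y)); split; first by exists (x, y).
case=> u _ /ub_optimalP[<- [su u_min]].
split; first by split=> //=; rewrite overlap_self ?ler_nat.
have [[/= sx sy _] _] := opt.
(* The diagonal pair of [z] is feasible for (UB-SMSP), so the optimal [u] costs no more than it. *)
have [z sz] := merged_schedule hp hq sx sy.
by apply: le_trans; rewrite !rec_cost_diag u_min.
Qed.
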